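(* Let $D_1$ and $D_2$ be two weak test-once decision graphs whose leaves are labeled true or false, let $op\in\{\wedge,\vee\}$, and let $p$ be the map assigning to every variable the set of all its states. Let $D_3$ be the output of $\mathrm{Apply}(D_1,D_2,p,op)$ (the procedure defined in the context). Then $D_3$ is a weak test-once decision graph whose leaves are labeled true or false, and $D_3$ is equivalent to $D_1\ op\ D_2$; that is, for every instance $\mathcal{I}$, the label of the leaf reached by $\mathcal{I}$ in $D_3$ equals $l_1\ op\ l_2$, where $l_1,l_2$ are the labels of the leaves reached by $\mathcal{I}$ in $D_1$ and $D_2$.
   Context: Variables are discrete, each with a finite set of at least two states; an instance assigns one state to each variable. A decision graph is a finite rooted directed acyclic graph whose leaves carry labels and in which each internal node tests a variable $V$ and has outgoing edges $(s,c)$, where $s$ is a nonempty set of states of $V$ and $c$ is the child node; the sets $s$ on the edges leaving a node are pairwise disjoint. An instance is evaluated by starting at the root and following at each node the edge whose set contains the instance's state of the tested variable. A decision graph is weak test-once if for every path from the root to a node $N$ testing $V$, the sets on the outgoing edges of $N$ partition the set of states of $V$ that are feasible at $N$ on that path, namely the set labeling the last edge on the path that leaves a node testing $V$, or the set of all states of $V$ if $V$ is not tested earlier on the path. A subgraph is identified with its root. The procedure $\mathrm{Apply}(D_1,D_2,p,op)$, where $p$ maps each variable $V$ to a set $p[V]$ of its states, is the following recursion (with an initially empty cache): (1) If $D_1$ or $D_2$ is the leaf true or the leaf false, let $D_3$ be $D_1\ op\ D_2$ (simplified with the constant: $\mathrm{true}\wedge D=D$, $\mathrm{false}\wedge D=\mathrm{false}$,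 $\mathrm{true}\vee D=\mathrm{true}$, $\mathrm{false}\vee D=D$, and symmetrically), remove from (a copy of) $D_3$ all states inconsistent with $p$ (i.e. replace each edge set $s$ at a node testing $V$ by $s\cap p[V]$, deleting edges whose set becomes empty), and return the result. (2) Let $p^\star$ be the restriction of $p$ to the variables occurring in $D_1,D_2$. If the cache has an entry for $(D_1,D_2,p^\star,op)$, return it. (3) Let $V_1,V_2$ be the variables tested at the roots of $D_1,D_2$, and let $E=\emptyset$. If $V_1=V_2$: for each edge $(s_1,c_1)$ of the root of $D_1$ and each edge $(s_2,c_2)$ of the root of $D_2$, let $s=s_1\cap s_2\cap p[V_1]$; if $s\neq\emptyset$, let $p'$ be $p$ with $p'[V_1]=s$, let $c=\mathrm{Apply}(c_1,c_2,p',op)$, and add the edge $(s,c)$ to $E$. If $V_1\ne V_2$: for each edge $(s_1,c_1)$ of the root of $D_1$, let $s=s_1\cap p[V_1]$; if $s\ne\emptyset$, let $p'$ be $p$ with $p'[V_1]=s$, let $c=\mathrm{Apply}(c_1,D_2,p',op)$, and add the edge $(s,c)$ to $E$. (4) Let $D_3$ be a decision node testing $V_1$ with edge set $E$; store it in the cache under $(D_1,D_2,p^\star,op)$ and return it. *)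

(* Defs.v *)
From HB Require Import structures.
From mathcomp Require Import all_boot.

Set Implicit Arguments.
Unset Strict Implicit.
Unset Printing Implicit Defensive.

(* Variables form an arbitrary eqType V; the states of v : V form the finType *)
(* T v.  Decision graphs live in a memory: a list of cells, a node being the  *)
(* address of a cell.  The graph rooted at r consists of the nodes reachable  *)
(* from r, so graphs may share nodes, a subgraph is given by its root, and    *)
(* cells that are unreachable from r are irrelevant to the graph rooted at r. *)

Section DecisionGraphs.

Variables (V : eqType) (T : V -> finType).

Definition edge (v : V) : Type := ({set T v} * nat)%type.

Inductive cell (L : Type) : Type :=
| Leaf of L
| Test (v : V) of seq (edge v).

Arguments Leaf {L}.
Arguments Test {L}.

Definition memory (L : Type) := seq (cell L).

Definition instance := forall v, T v.

Definition assignment := forall v, {set T v}.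

Definition all_states : assignment := fun v => [set: T v].

(* What labels an edge of a path: the variable tested at its source and its   *)
(* set of states.                                                             *)
Definition label := {v : V & {set T v}}.

Section Graphs.

Variables (L : Type) (M : memory L).

Inductive dpath (r : nat) : seq label -> nat -> Prop :=
| dpath_nil : dpath r [::] r
| dpath_rcons tr n v es s c of
    dpath r tr n & onth M n = Some (Test v es) & (s, c) \in es :
    dpath r (rcons tr (Tagged (fun v => {set T v}) s)) c.

(* The set on the last label of tr that concerns v, and all the states of v   *)
(* if there is none: dfwith f s is f updated to s at the variable of s.       *)
Definition feasible (tr : seq label) : assignment :=
  foldl (fun (f : assignment) (e : label) => dfwith f (tagged e)) all_states tr.

Definition wf_cell (c : cell L) : Prop :=
  match c with
  | Leaf _ => True
  | Test v es =>
      [/\ es != [::], all (fun e : edge v => e.1 != set0) es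
        & pairwise (fun e1 e2 : edge v => [disjoint e1.1 & e2.1]) es]
  end.

(* Finiteness of the graph holds because the memory is finite and, by the     *)
(* second conjunct, every reachable address is allocated.                     *)
Definition decision_graph (r : nat) : Prop :=
  [/\ forall tr n tr', dpath r tr n -> dpath n tr' n -> tr' = [::]
    & forall tr n, dpath r tr n -> exists2 c, onth M n = Some c & wf_cell c].

(* In a decision graph the edges leaving a node carry disjoint nonempty sets, *)
(* hence no two of them are identified in the set of sets below.              *)
Definition weak_test_once (r : nat) : Prop :=
  forall tr n v es, dpath r tr n -> onth M n = Some (Test v es) ->
  partition [set s | s in unzip1 es] (feasible tr v).

Inductive reaches (I : instance) : nat -> L -> Prop :=
| reaches_leaf n l of onth M n = Some (Leaf l) : reaches I n l
| reaches_test n v es s c l of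
    onth M n = Some (Test v es) & (s, c) \in es & I v \in s & reaches I c l :
    reaches I n l.

(* A leaf is reached, and its label is l.                                     *)
Definition evaluates (r : nat) (I : instance) (l : L) : Prop :=
  forall l', reaches I r l' <-> l' = l.

Definition children (n : nat) : seq nat :=
  if onth M n is Some (Test _ es) then unzip2 es else [::].

(* The nodes of the subgraph rooted at r, by increasing address; size M       *)
(* rounds of expansion are enough to collect all of them.                     *)
Definition descendants (r : nat) : seq nat :=
  let expand s := undup (s ++ flatten [seq children x | x <- s]) in
  let ds := iter (size M) expand [:: r] in
  [seq n <- iota 0 (size M) | n \in ds].

Definition tested (n : nat) : seq V :=
  if onth M n is Some (Test v _) then [:: v] else [::].

Definition occurring (D1 D2 : nat) : seq V :=
  undup (flatten [seq tested n | n <- descendants D1 ++ descendants D2]).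

Definition restrict_cell (p : assignment) (rename : nat -> nat) (c : cell L) :
    cell L :=
  match c with
  | Leaf l => Leaf l
  | Test v es =>
      Test v [seq (e.1 :&: p v, rename e.2) | e <- es & e.1 :&: p v != set0]
  end.

(* Appends to the memory a copy of the subgraph rooted at r from which the    *)
(* states inconsistent with p have been removed; returns the copy's root.     *)
Definition restricted_copy (r : nat) (p : assignment) : nat * memory L :=
  let ds := descendants r in
  let rename n := size M + index n ds in
  (rename r,
   M ++ pmap (fun n => omap (restrict_cell p rename) (onth M n)) ds).

End Graphs.

End DecisionGraphs.

Arguments Leaf {V T L}.
Arguments Test {V T L}.

Inductive boolop := Conj | Disj.

Definition bool_of_boolop op := if op is Conj then true else false.
Definition boolop_of_bool (b : bool) := if b then Conj else Disj.
Lemma bool_of_boolopK : cancel bool_of_boolop boolop_of_bool.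
Proof. by case. Qed.
HB.instance Definition _ := Equality.copy boolop (can_type bool_of_boolopK).

Definition eval_op (op : boolop) : bool -> bool -> bool :=
  if op is Conj then andb else orb.

Section Apply.

Variables (V : eqType) (T : V -> finType).

Local Notation memory := (memory T bool).
Local Notation edge := (edge T).

(* The restriction of an assignment to finitely many variables.               *)
Definition restriction (p : assignment T) (vs : seq V) : seq (label T) :=
  [seq Tagged (fun v => {set T v}) (p v) | v <- vs].

Definition key : eqType := (nat * nat * seq (label T) * boolop)%type.

Definition cache := seq (key * nat).

Definition lookup (k : key) (C : cache) : option nat :=
  ohead [seq e.2 | e <- C & e.1 == k].

Definition state := (memory * cache)%type.

(* The node b op D, where b is the label of the leaf at address B.            *)
Definition simplify (op : boolop) (b : bool) (B D : nat) : nat :=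
  match op, b with
  | Conj, true => D
  | Conj, false => B
  | Disj, true => B
  | Disj, false => D
  end.

(* The recursive calls to be considered when the roots test v1 and v2 and     *)
(* have outgoing edges es1 and es2: (s, (c1, c2)) stands for a call on c1 and *)
(* c2 for the states in s, before intersection with p[v1].                    *)
Definition branches (v1 : V) (es1 : seq (edge v1)) (v2 : V)
    (es2 : seq (edge v2)) (D2 : nat) : seq ({set T v1} * (nat * nat)) :=
  match v2 =P v1 with
  | ReflectT eq_v =>
      [seq (e1.1 :&: e2.1, (e1.2, e2.2))
         | e1 <- es1, e2 <- ecast v (seq (edge v)) eq_v es2]
  | ReflectF _ => [seq (e1.1, (e1.2, D2)) | e1 <- es1]
  end.

(* Runs body on the items of xs in order, collecting the edges it produces.   *)
Fixpoint for_each (A B : Type) (body : A -> state -> option (seq B * state))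
    (xs : seq A) (st : state) : option (seq B * state) :=
  if xs is x :: xs' then
    if body x st is Some (E, st1) then
      if for_each body xs' st1 is Some (E', st2) then Some (E ++ E', st2)
      else None
    else None
  else Some ([::], st).

(* None is returned only if the recursion is deeper than fuel or if a         *)
(* dangling address is met.                                                   *)
Fixpoint apply_rec (fuel : nat) (D1 D2 : nat) (p : assignment T) (op : boolop)
    (st : state) : option (nat * state) :=
  if fuel isn't fuel'.+1 then None else
  let: (M, C) := st in
  let return_copy D :=
    let: (D3, M') := restricted_copy M D p in Some (D3, (M', C)) in
  match onth M D1, onth M D2 with
  | Some (Leaf b1), Some _ => return_copy (simplify op b1 D1 D2)
  | Some _, Some (Leaf b2) => return_copy (simplify op b2 D2 D1)
  | Some (Test v1 es1), Some (Test v2 es2) =>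
      let k : key := (D1, D2, restriction p (occurring M D1 D2), op) in
      if lookup k C is Some D3 then Some (D3, st) else
      let body x st :=
        let: (s0, (c1, c2)) := x in
        let s := s0 :&: p v1 in
        if s == set0 then Some ([::], st) else
        if apply_rec fuel' c1 c2 (dfwith p s) op st is Some (c, st')
        then Some ([:: (s, c)], st') else None in
      if for_each body (branches es1 es2 D2) st is Some (E, (M', C'))
      then Some (size M', (rcons M' (Test v1 E), (k, size M') :: C'))
      else None
  | _, _ => None
  end.

(* Every recursive call moves from D1 to one of its children, so that the     *)
(* depth of the recursion on an acyclic D1 is at most the number of nodes.    *)
Definition Apply (M : memory) (D1 D2 : nat) (p : assignment T) (op : boolop) :
    option (nat * memory) :=
  if apply_rec (size M) D1 D2 p op (M, [::]) is Some (D3, (M', _))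
  then Some (D3, M') else None.

End Apply.

(* Main.v *)
Require Import Defs.
From mathcomp Require Import all_boot.

(* Along a path of the output graph, p[V] is the set on the last label that   *)
(* concerns V, and it is contained in the states of V feasible on the two     *)
(* corresponding paths of D1 and D2. Intersecting with p[V1] the sets leaving *)
(* a node of D1 (or the pairwise intersections of those leaving two nodes     *)
(* that test the same variable) therefore gives a partition of p[V1], the     *)
(* feasible set of V1 in the output. A result depends on p only through the   *)
(* variables tested below D1 and D2, which are recorded in the cache key.     *)

Set Implicit Arguments.
Unset Strict Implicit.
Unset Printing Implicit Defensive.

(** The argument is an induction on the recursion, with paths replaced by what they make feasible.
    [bounded_wto] says that the graph below a node is weak test-once when entered with feasible sets
    [f], a depth bound standing in for acyclicity. [weak_test_once_bounded],
    [bounded_wto_decision_graph] and [bounded_wto_weak_test_once] translate between this local form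
    and the definitions on paths.

    A call of [apply_rec] is made on two nodes that are good for some [f1] and [f2], with [p]
    nowhere empty and contained in both. Its output is then good for [p] itself, and computes [op]
    on the instances that agree with [p] on the variables occurring in the arguments; this is
    [result]. If an argument is a leaf, the output is a copy of an argument intersected with [p]
    ([bounded_wto_copy], [reaches_copy]). If both are tests, the branches are disjoint and cover
    [p v1] ([branches_disjoint], [branches_cover]), each recursive call inherits the invariant
    ([branch_child]), and an instance follows a branch that leads to the right pair of children
    ([branch_reaches]). On a cache hit, [result] carries over because it sees [p] only on occurring
    variables ([result_eq]). [apply_rec_correct] assembles the cases. *)

Section Splits.

(** * Partitions given as lists of disjoint sets *)

Variable X : finType.
Implicit Types (A B : {set X}) (ss : seq {set X}).

Definition disjoint_seq ss :=
  pairwise (fun s1 s2 : {set X} => [disjoint s1 & s2]) ss.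

(** A partition kept as a list, so that it stays aligned with the edges of a node. *)
Definition splits A ss :=
  [/\ all (fun s => s != set0) ss, disjoint_seq ss
    & forall x, (x \in A) = has (fun s : {set X} => x \in s) ss].

Lemma disjoint_seq_eq ss s1 s2 x : disjoint_seq ss ->
  s1 \in ss -> s2 \in ss -> x \in s1 -> x \in s2 -> s1 = s2.
Proof.
elim: ss => //= s ss IH /andP[/allP dis_s dis_ss].
rewrite !inE => /orP[/eqP->|s1_ss] /orP[/eqP->|s2_ss] // x1 x2.
- by have /disjointFr/(_ x1) := dis_s _ s2_ss; rewrite x2.
- by have /disjointFr/(_ x2) := dis_s _ s1_ss; rewrite x1.
exact: IH.
Qed.

Lemma splits_partition A ss :
  splits A ss -> partition [set s | s in ss] A.
Proof.
case=> ne dis cov; apply/and3P; split.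
- apply/eqP/setP=> x; rewrite cov; apply/bigcupP/hasP => -[s].
    by case/imsetP=> s' ss' -> xs; exists s'.
  by move=> ss_s xs; exists s => //; apply/imsetP; exists s.
- apply/trivIsetP=> _ _ /imsetP[s1 ss1 ->] /imsetP[s2 ss2 ->] neq.
  rewrite -setI_eq0; apply/eqP/setP=> x; rewrite !inE.
  apply/negP=> /andP[x1 x2].
  by rewrite (disjoint_seq_eq dis ss1 ss2 x1 x2) eqxx in neq.
- apply/negP=> /imsetP[s ss_s s0].
  by move/allP: ne => /(_ _ ss_s); rewrite -s0 eqxx.
Qed.

Lemma disjoint_seq_sub ss ss' (f : {set X} -> {set X}) :
  (forall s, f s \subset s) -> disjoint_seq ss -> disjoint_seq (map f ss).
Proof.
move=> sub_f; rewrite /disjoint_seq pairwise_map; apply: sub_pairwise => s1 s2.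
by move=> dis /=; apply: disjointWl (sub_f _) (disjointWr (sub_f _) dis).
Qed.

(** A cover of [B] is enough: the intersection discards the points outside [B], and the filter
    removes the sets that become empty, just as the procedure deletes edges. *)
Lemma splits_restrict B ss : disjoint_seq ss ->
  (forall x, x \in B -> has (fun s : {set X} => x \in s) ss) ->
  splits B [seq s <- [seq s :&: B | s <- ss] | s != set0].
Proof.
move=> dis cov; split; first exact: filter_all.
  apply: pairwise_filter; apply: disjoint_seq_sub dis => // s.
  exact: subsetIl.
move=> x; apply/idP/hasP => [xB|[s]].
  have /hasP[s s_ss xs] := cov _ xB; exists (s :&: B); last by rewrite inE xs.
  rewrite mem_filter (map_f (fun s => s :&: B)) // andbT; apply/set0Pn; exists x.
  by rewrite inE xs.
by rewrite mem_filter => /andP[_ /mapP[s' _ ->]]; rewrite inE => /andP[].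
Qed.

Lemma disjoint_seq_allpairs ss1 ss2 : disjoint_seq ss1 -> disjoint_seq ss2 ->
  disjoint_seq [seq s1 :&: s2 | s1 <- ss1, s2 <- ss2].
Proof.
move=> + dis2; elim: ss1 => //= s ss1 IH /andP[/allP dis_s dis1].
rewrite /disjoint_seq pairwise_cat; apply/and3P; split; last exact: IH.
  apply/allrelP=> _ _ /mapP[t2 _ ->] /allpairsP[[s' t'] [/= s'_in _ ->]].
  apply: disjointWl (subsetIl _ _) (disjointWr (subsetIl _ _) _).
  exact: dis_s.
apply: disjoint_seq_sub dis2 => // t; exact: subsetIr.
Qed.

End Splits.

(** Serves to merge the depth bounds of the children of a new node into a single one. *)
Lemma seq_uniform_bound (A : eqType) (P : nat -> A -> Prop) (s : seq A) :
  (forall i j x, i <= j -> P i x -> P j x) ->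
  (forall x, x \in s -> exists k, P k x) -> exists k, forall x, x \in s -> P k x.
Proof.
move=> mono; elim: s => [|a s IH] ex; first by exists 0.
have [k Pk] : exists k, forall x, x \in s -> P k x.
  by apply: IH => x xs; apply: ex; rewrite inE xs orbT.
have [i Pi] := ex a (mem_head _ _).
exists (maxn i k) => x; rewrite inE => /orP[/eqP->|/Pk].
  exact: mono (leq_maxl _ _) Pi.
exact: mono (leq_maxr _ _).
Qed.

(** As [f] is defined on all of [s], [pmap] drops nothing and positions are kept; this locates a
    copied cell. *)
Lemma onth_pmap_index (A : eqType) (B : Type) (f : A -> option B) s x :
  (forall y, y \in s -> f y) -> x \in s -> onth (pmap f s) (index x s) = f x.
Proof.
elim: s => //= y s IH fs; rewrite inE.
have fy : f y by apply: fs; exact: mem_head.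
rewrite [y == x]eq_sym; case: eqP => [->|_] /= xs.
  by case: (f y) fy.
case: (f y) fy => //= b _; apply: IH => // z zs.
by apply: fs; rewrite inE zs orbT.
Qed.

(** * Growing memories and depth-bounded weak test-once graphs *)

Section Graphs.

Variables (V : eqType) (T : V -> finType) (L : Type).

Local Notation memory := (memory T L).
Local Notation assignment := (assignment T).

Implicit Types (M : memory) (f p : assignment) (I : instance T) (A : V -> Prop).

(** The procedure never overwrites a cell, so what is proved of an address survives in every later
    memory. *)
Definition extends M M' := forall n c, onth M n = Some c -> onth M' n = Some c.

Lemma extends_refl M : extends M M. Proof. by []. Qed.

Lemma extends_trans M1 M2 M3 : extends M1 M2 -> extends M2 M3 -> extends M1 M3.
Proof. by move=> e12 e23 n c /e12/e23. Qed.

Lemma extends_cat M M1 : extends M (M ++ M1).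
Proof.
move=> n c Mn; rewrite onth_cat; case: ltnP => // leMn.
by rewrite onth_default in Mn.
Qed.

Lemma extends_size M M' : extends M M' -> size M <= size M'.
Proof.
case: (posnP (size M)) => [->//|M_gt0] ext.
have: onth M (size M).-1 by rewrite onthTE prednK.
case Mn: (onth M _) => [c|//] _; have := onthTE M' (size M).-1.
by rewrite (ext _ _ Mn) prednK.
Qed.

(* Weak test-once relative to the feasible states f at n, instead of to a     *)
(* path from the root. The depth bound k also yields acyclicity, and knowing  *)
(* the tested variables A lets f be changed outside A.                        *)
Fixpoint bounded_wto M A k f n : Prop :=
  if k isn't k'.+1 then False else
  match onth M n with
  | Some (Leaf _) => True
  | Some (Test v es) =>
      [/\ A v, f v != set0, splits (f v) (unzip1 es)
        & forall e, e \in es -> bounded_wto M A k' (dfwith f e.1) e.2]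
  | None => False
  end.

Lemma bounded_wtoW M A M' A' i j f f' n : extends M M' ->
  (forall v, A v -> A' v) -> (forall v, A v -> f v = f' v) -> i <= j ->
  bounded_wto M A i f n -> bounded_wto M' A' j f' n.
Proof.
move=> ext sAA'; elim: i j f f' n => [|i IH] [|j] f f' n //= eq_f le_ij.
case Mn: (onth M n) => [[l|v es]|] //=; rewrite (ext _ _ Mn) //.
case=> Av f_ne split_f sub; rewrite -eq_f //; split=> //; first exact: sAA'.
move=> e /sub; apply: IH => // w Aw.
by case: (eqVneq v w) => [<-|ne]; rewrite ?dfwith_in ?dfwith_out ?eq_f.
Qed.

Lemma bounded_wto_test M A k f n v (es : seq (edge T v)) :
  bounded_wto M A k f n -> onth M n = Some (Test v es) ->
  [/\ A v, f v != set0, splits (f v) (unzip1 es)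
    & forall e, e \in es -> bounded_wto M A k.-1 (dfwith f e.1) e.2].
Proof. by case: k => //= k + Mn; rewrite Mn. Qed.

Lemma splits_wf v (es : seq (edge T v)) (B : {set T v}) :
  B != set0 -> splits B (unzip1 es) -> wf_cell (Test v es : cell T L).
Proof.
move=> /set0Pn[x xB] [ne dis cov]; split.
- by apply/eqP=> es0; rewrite cov es0 in xB.
- by rewrite all_map in ne.
- by rewrite /disjoint_seq pairwise_map in dis.
Qed.

Lemma bounded_wto_dpath M A k f r tr n : bounded_wto M A k f r ->
  dpath M r tr n ->
  bounded_wto M A (k - size tr)
    (foldl (fun (f : assignment) (e : label T) => dfwith f (tagged e)) f tr) n.
Proof.
move=> wto_r; elim=> [|{}tr m v es s c _ IH Mm es_sc]; first by rewrite subn0.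
rewrite foldl_rcons size_rcons subnS; case: (k - size tr) IH => //= j.
by rewrite Mm => -[_ _ _ /(_ _ es_sc)].
Qed.

(** A nonempty cycle at [n] would make [n] good for a smaller bound. It also changes the feasible
    sets, hence the induction over all [f]. *)
Lemma bounded_wto_acyclic M A k f n tr :
  bounded_wto M A k f n -> dpath M n tr n -> tr = [::].
Proof.
elim/ltn_ind: k f => k IH f wto_n path_n; case: (posnP (size tr)).
  by move/size0nil.
move=> tr_gt0; have wto_n' := bounded_wto_dpath wto_n path_n.
apply: IH wto_n' path_n; rewrite ltn_subrL tr_gt0.
by case: k wto_n.
Qed.

Lemma bounded_wto_decision_graph M A k f r :
  bounded_wto M A k f r -> decision_graph M r.
Proof.
move=> wto_r; split=> [tr n tr' /(bounded_wto_dpath wto_r)|].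
  exact: bounded_wto_acyclic.
move=> tr n /(bounded_wto_dpath wto_r); case: (k - _) => //= j.
case: (onth M n) => [[l|v es]|] //.
  by move=> _; exists (Leaf l).
by case=> _ ne spl _; exists (Test v es) => //; exact: splits_wf ne spl.
Qed.

Lemma bounded_wto_weak_test_once M A k r :
  bounded_wto M A k (@all_states V T) r -> weak_test_once M r.
Proof.
move=> wto_r tr n v es /(bounded_wto_dpath wto_r); case: (k - _) => //= j.
by move=> + Mn; rewrite Mn => -[_ _ spl _]; apply: splits_partition.
Qed.

(** By acyclicity the nodes along a path are pairwise distinct, and all are allocated, so there are
    at most [size M] of them. *)
Lemma dpath_size M r tr n :
  decision_graph M r -> dpath M r tr n -> size tr < size M.
Proof.
case=> acyc alloc path_n; suff [ns [<- ns_uniq ns_path]]: exists ns : seq nat,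
    [/\ size ns = (size tr).+1, uniq ns
      & forall m, m \in ns ->
          exists t1 t2, dpath M r t1 m /\ dpath M m t2 n].
  rewrite -[leqRHS](size_iota 0); apply: uniq_leq_size => // m.
  case/ns_path=> t1 [_ [/alloc[c Mm _] _]]; rewrite mem_iota add0n.
  by rewrite -onthTE Mm.
elim: path_n => [|{}tr {}n v es s c path_n [ns [sz ns_uniq ns_path]] Mn es_sc].
  exists [:: r]; split=> // m; rewrite inE => /eqP->.
  by exists [::], [::]; split; constructor.
have path_c := dpath_rcons path_n Mn es_sc.
exists (c :: ns); split=> [||m].
- by rewrite size_rcons /= sz.
(* If [c] were an earlier node, the path from it to [n] followed by the new edge would be a
   cycle. *)
- rewrite /= ns_uniq andbT; apply/negP=> /ns_path[t1 [t2 [path1 path2]]].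
  have := acyc _ _ _ path1 (dpath_rcons path2 Mn es_sc).
  by move/(congr1 size); rewrite size_rcons.
rewrite inE => /orP[/eqP->|/ns_path[t1 [t2 [path1 path2]]]].
  by exists (rcons tr (Tagged (fun v => {set T v}) s)), [::]; split=> //; constructor.
exists t1, (rcons t2 (Tagged (fun v => {set T v}) s)); split=> //.
exact: dpath_rcons path2 Mn es_sc.
Qed.

(** The length of the path plus the remaining depth stays at least [size M], so by [dpath_size] the
    depth cannot run out. *)
Lemma weak_test_once_bounded M r : decision_graph M r ->
  weak_test_once M r -> bounded_wto M (fun=> True) (size M) (@all_states V T) r.
Proof.
move=> graph_r wto_r; have [_ alloc] := graph_r.
suff H k tr n : dpath M r tr n -> size M <= k + size tr ->
    bounded_wto M (fun=> True) k (feasible tr) n.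
  by apply: (H _ [::]); [constructor | rewrite addn0].
elim: k tr n => [|k IH] tr n path_n /=.
  by rewrite leqNgt (dpath_size graph_r path_n).
move=> le_k; have [c Mn wf_c] := alloc _ _ path_n.
case: c Mn wf_c => [l|v es] Mn; rewrite Mn // => -[es_ne ne dis].
have /and3P[/eqP cov _ _] := wto_r _ _ _ _ path_n Mn.
have spl : splits (feasible tr v) (unzip1 es).
  split; rewrite /disjoint_seq ?all_map ?pairwise_map // => x; rewrite -cov.
  apply/bigcupP/hasP => -[s]; first by case/imsetP=> s' s'_es ->; exists s'.
  by move=> s_es xs; exists s => //; apply/imsetP; exists s.
split=> //.
  (* The feasible set contains the nonempty set of the first edge. *)
  case: es es_ne ne {Mn dis cov} spl => // e es _ /=.
  case/andP=> /set0Pn[x xe] _ [_ _ /(_ x) /=]; rewrite xe /= => xf.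
  by apply/set0Pn; exists x.
move=> [s c] es_sc; have path_c := dpath_rcons path_n Mn es_sc.
have := IH _ _ path_c; rewrite /feasible foldl_rcons; apply.
by rewrite size_rcons addnS -addSn.
Qed.

(** * Existence and uniqueness of the leaf reached by an instance *)

Lemma reachesP M I n l : reaches M I n l <->
  match onth M n with
  | Some (Leaf l') => l = l'
  | Some (Test v es) =>
      exists e, [/\ e \in es, I v \in e.1 & reaches M I e.2 l]
  | None => False
  end.
Proof.
split=> [[m l' ->|m v es s c l' -> es_sc Is reach_c]|] //; first by exists (s, c).
case Mn: (onth M n) => [[l'|v es]|] //; first by move->; exact: reaches_leaf.
by case=> -[s c] [es_sc Is reach_c]; exact: reaches_test Mn es_sc Is reach_c.
Qed.

Lemma reaches_extends M M' I n l :
  extends M M' -> reaches M I n l -> reaches M' I n l.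
Proof.
move=> ext; elim=> [m l' /ext|m v es s c l' /ext Mm es_sc Is _].
  exact: reaches_leaf.
exact: reaches_test Mm es_sc Is.
Qed.

Lemma bounded_wto_reaches M A k f n I : bounded_wto M A k f n ->
  (forall v, I v \in f v) -> exists l, reaches M I n l.
Proof.
elim: k f n => //= k IH f n; case Mn: (onth M n) => [[l|v es]|] //.
  by exists l; exact: reaches_leaf.
case=> _ _ [_ _ cov] sub If; have := If v.
rewrite cov has_map => /hasP[[s c] es_sc Is].
have [w|l reach_c] := IH _ _ (sub _ es_sc).
  by case: dfwithP => [|w' _]; [exact: Is | exact: If].
by exists l; exact: reaches_test Mn es_sc Is reach_c.
Qed.

Lemma edge_eq v (es : seq (edge T v)) e1 e2 x : disjoint_seq (unzip1 es) ->
  e1 \in es -> e2 \in es -> x \in e1.1 -> x \in e2.1 -> e1 = e2.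
Proof.
elim: es => //= e es IH /andP[/allP dis_e dis_es].
rewrite !inE => /orP[/eqP->|e1_es] /orP[/eqP->|e2_es] // x1 x2.
- by have /disjointFr/(_ x1) := dis_e _ (map_f _ e2_es); rewrite x2.
- by have /disjointFr/(_ x2) := dis_e _ (map_f _ e1_es); rewrite x1.
exact: IH.
Qed.

Lemma bounded_wto_reaches_inj M A k f n I l l' : bounded_wto M A k f n ->
  reaches M I n l -> reaches M I n l' -> l = l'.
Proof.
elim: k f n => //= k IH f n + /reachesP + /reachesP.
case: (onth M n) => [[l1|v es]|] //; first by move=> _ -> ->.
case=> _ _ [_ dis _] sub [e [es_e Ie re]] [e' [es_e' Ie' re']].
by rewrite -(edge_eq dis es_e es_e' Ie Ie') in re'; exact: IH (sub _ es_e) re re'.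
Qed.

Lemma bounded_wto_evaluates M A k f n I l : bounded_wto M A k f n ->
  reaches M I n l -> evaluates M n I l.
Proof.
move=> wto_n rl l'; split=> [rl'|->//].
exact: bounded_wto_reaches_inj wto_n rl' rl.
Qed.

(** * Occurring variables and the computation of descendants *)

Inductive occurs M (v : V) : nat -> Prop :=
| occurs_root n es of onth M n = Some (Test v es) : occurs M v n
| occurs_child n w es e of onth M n = Some (Test w es) & e \in es
    & occurs M v e.2 : occurs M v n.

(** The iteration inside [descendants], with its number of rounds made a parameter. *)
Definition expansion M j r :=
  iter j (fun s => undup (s ++ flatten [seq children M x | x <- s])) [:: r].

Lemma expansion_le M i j r : i <= j ->
  {subset expansion M i r <= expansion M j r}.
Proof.
move=> le_ij n; rewrite -(subnK le_ij) /expansion iterD.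
by elim: (j - i) => //= d IH ni; rewrite mem_undup mem_cat IH.
Qed.

Lemma expansion_child M j r n v es e : n \in expansion M j r ->
  onth M n = Some (Test v es) -> e \in es -> e.2 \in expansion M j.+1 r.
Proof.
move=> nj Mn es_e; rewrite /= mem_undup mem_cat; apply/orP; right.
apply/flattenP; exists (children M n); first exact: map_f.
by rewrite /children Mn map_f.
Qed.

Lemma mem_descendants M j r n : n < size M -> j <= size M ->
  n \in expansion M j r -> n \in descendants M r.
Proof.
move=> ltn lej nj; rewrite mem_filter mem_iota ltn !andbT.
exact: expansion_le lej _ nj.
Qed.

Lemma tested_occurring M N1 N2 r n v es : r \in [:: N1; N2] ->
  n \in descendants M r -> onth M n = Some (Test v es) ->
  v \in occurring M N1 N2.
Proof.
move=> r12 nr Mn; rewrite mem_undup; apply/flattenP; exists (tested M n).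
  apply: map_f; rewrite mem_cat; move: r12; rewrite !inE.
  by case/orP=> /eqP<-; rewrite nr ?orbT.
by rewrite /tested Mn mem_head.
Qed.

(** A node found after [j] rounds and having depth bound [k] satisfies [j + k <= size M], a relation
    kept on the way down; hence [size M] rounds suffice. *)
Lemma occurs_occurring M0 M A N1 N2 r k f v : extends M0 M ->
  bounded_wto M0 A k f r -> k <= size M -> r \in [:: N1; N2] ->
  occurs M0 v r -> v \in occurring M N1 N2.
Proof.
move=> ext wto_r le_k r12 occ.
suff H j n : occurs M0 v n -> n \in expansion M j r -> forall k f,
    bounded_wto M0 A k f n -> j + k <= size M -> v \in occurring M N1 N2.
  by apply: (H 0) occ _ _ _ wto_r le_k; rewrite mem_head.
move=> {k f wto_r le_k occ} occ; elim: occ j => {}n.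
  move=> es Mn j nj [|k] f //= _ le_jk; have := ext _ _ Mn.
  apply: (tested_occurring r12); apply: (mem_descendants _ _ nj).
    by rewrite -onthTE (ext _ _ Mn).
  by apply: leq_trans le_jk; exact: leq_addr.
move=> w es e Mn es_e _ IH j nj [|k] f //=; rewrite Mn => -[_ _ _ sub].
rewrite addnS -addSn; apply: IH (sub _ es_e).
exact: expansion_child nj (ext _ _ Mn) es_e.
Qed.

(** * Copies restricted to an assignment *)

Lemma extends_restricted_copy M r p : extends M (restricted_copy M r p).2.
Proof. exact: extends_cat. Qed.

Lemma unzip1_restrict_edges v (B : {set T v}) (rename : nat -> nat) es :
  unzip1 [seq (e.1 :&: B, rename e.2) | e <- es & e.1 :&: B != set0] =
  [seq s <- [seq s :&: B | s <- unzip1 es] | s != set0].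
Proof. by elim: es => //= e es IH; case: ifP; rewrite /= IH. Qed.

Lemma onth_restricted_copy M r p n c : n \in descendants M r ->
  onth M n = Some c ->
  let rename m := size M + index m (descendants M r) in
  onth (restricted_copy M r p).2 (rename n) = Some (restrict_cell p rename c).
Proof.
move=> n_ds Mn /=; rewrite onth_cat ltnNge leq_addr /= addKn.
rewrite onth_pmap_index ?Mn // => m; rewrite mem_filter mem_iota => /and3P[_ _].
by rewrite add0n -onthTE; case: (onth M m).
Qed.

Section RestrictedCopy.

Variables (M0 M : memory) (r : nat) (p : assignment).
Hypothesis ext : extends M0 M.

Let copy := (restricted_copy M r p).2.
Let rename m := size M + index m (descendants M r).

Let onth_copy j k n c : n \in expansion M j r -> j + k <= size M ->
  onth M0 n = Some c -> onth copy (rename n) = Some (restrict_cell p rename c).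
Proof.
move=> nj le_jk /ext Mn; apply: (onth_restricted_copy p _ Mn).
apply: mem_descendants nj; first by rewrite -onthTE Mn.
exact: leq_trans (leq_addr _ _) le_jk.
Qed.

(** The relation between [f], [g] and [p] is preserved along an edge: its set [s] becomes the
    feasible set in the original, and [s :&: p v] in the copy. *)
Lemma bounded_wto_copy A B j k f g n : bounded_wto M0 A k f n ->
  (forall v, g v = f v :&: p v) -> (forall v, g v != set0) ->
  (forall v, occurs M0 v n -> B v) ->
  n \in expansion M j r -> j + k <= size M ->
  bounded_wto copy B k g (rename n).
Proof.
elim: k j f g n => //= k IH j f g n.
case Mn: (onth M0 n) => [c|] //; move: Mn.
case: c => [l|v es] Mn wto_n gE g_ne occB nj le_jk;
  rewrite (onth_copy nj le_jk Mn) //=.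
have [_ _ [_ dis cov] sub] := wto_n.
have spl : splits (g v) [seq s <- [seq s :&: p v | s <- unzip1 es] | s != set0].
  (* An edge set lies inside [f v], so it meets [p v] and [g v] in the same states. *)
  have E s : s \in unzip1 es -> s :&: p v = s :&: g v.
    move=> s_es; rewrite gE setIA; congr (_ :&: _); apply/esym/setIidPl.
    by apply/subsetP=> x xs; rewrite cov; apply/hasP; exists s.
  move/eq_in_map: E => ->; apply: splits_restrict => // x.
  by rewrite gE inE cov => /andP[].
split=> //.
- by apply: occB; exact: occurs_root Mn.
- by rewrite unzip1_restrict_edges.
move=> e' /mapP[e]; rewrite mem_filter => /andP[e_ne es_e] -> /=.
apply: IH (sub _ es_e) _ _ _ (expansion_child nj (ext Mn) es_e) _ => [w|w|w occ|].
- by case: (eqVneq v w) => [<-|ne]; rewrite ?dfwith_in ?dfwith_out.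
- by case: dfwithP.
- by apply: occB; exact: occurs_child Mn es_e occ.
- by rewrite addSn -addnS.
Qed.

Lemma reaches_copy A j k f n I l : bounded_wto M0 A k f n ->
  (forall v, occurs M0 v n -> I v \in p v) ->
  n \in expansion M j r -> j + k <= size M ->
  reaches M0 I n l -> reaches copy I (rename n) l.
Proof.
elim: k j f n => //= k IH j f n wto_n Ip nj le_jk /reachesP reach_n.
apply/reachesP.
case Mn: (onth M0 n) wto_n reach_n => [[l'|v es]|] //;
  rewrite (onth_copy nj le_jk Mn) //=.
case=> _ _ _ sub [e [es_e Ie reach_e]]; exists (e.1 :&: p v, rename e.2).
have Iep : I v \in e.1 :&: p v.
  by rewrite inE Ie Ip //; exact: occurs_root Mn.
split=> //.
  apply/mapP; exists e => //; rewrite mem_filter es_e andbT.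
  by apply/set0Pn; exists (I v).
apply: IH (sub _ es_e) _ (expansion_child nj (ext Mn) es_e) _ reach_e => [w occ|].
  by apply: Ip; exact: occurs_child Mn es_e occ.
by rewrite addSn -addnS.
Qed.

End RestrictedCopy.

End Graphs.

(** * Cache keys, the loop over branches, and the branches themselves *)

Section Apply.

Variables (V : eqType) (T : V -> finType).

Local Notation memory := (memory T bool).
Local Notation assignment := (assignment T).
Local Notation state := (state T).
Local Notation cache := (cache T).

Implicit Types (M : memory) (f p : assignment) (I : instance T) (C : cache).

Lemma eq_restriction p p' vs vs' v : restriction p vs = restriction p' vs' ->
  v \in vs -> p v = p' v.
Proof.
elim: vs vs' => [|w vs IH] [|w' vs'] //= [eq_w].
case: w' / eq_w => eq_s eq_vs; rewrite inE => /orP[/eqP->|].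
  exact: eq_from_Tagged eq_s.
exact: IH eq_vs.
Qed.

Lemma restriction_domain p p' vs vs' :
  restriction p vs = restriction p' vs' -> vs = vs'.
Proof.
move=> /(congr1 (map tag)); rewrite -!map_comp.
by rewrite !(eq_map (g := id)) // !map_id.
Qed.

Lemma lookup_mem (k : key T) C n : lookup k C = Some n -> (k, n) \in C.
Proof.
rewrite /lookup; elim: C => //= -[k' n'] C IH; case: eqP => /= [-> [->]|_ /IH].
  exact: mem_head.
by rewrite inE orbC => ->.
Qed.

(** Loop rule: [Q] ties a branch to the node computed for it and must survive later allocations. Of
    the last two clauses, the first serves for the structure of the new node, the second for its
    evaluation. *)
Lemma for_each_edges (X : finType) (B : {set X})
    (body : {set X} * (nat * nat) -> state ->
            option (seq ({set X} * nat) * state))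
    (Inv : state -> Prop) (Q : {set X} * (nat * nat) -> nat -> memory -> Prop)
    (xs : seq ({set X} * (nat * nat))) (st : state) :
  (forall x c M M', extends M M' -> Q x c M -> Q x c M') ->
  (forall x st0, x \in xs -> Inv st0 ->
     if x.1 :&: B == set0 then body x st0 = Some ([::], st0)
     else exists c st1, [/\ body x st0 = Some ([:: (x.1 :&: B, c)], st1),
            Inv st1, extends st0.1 st1.1 & Q x c st1.1]) ->
  Inv st ->
  exists E st', [/\ for_each body xs st = Some (E, st'),
    Inv st' /\ extends st.1 st'.1,
    unzip1 E = [seq s <- [seq s :&: B | s <- unzip1 xs] | s != set0],
    forall e, e \in E -> exists x, [/\ x \in xs, e.1 = x.1 :&: B,
      x.1 :&: B != set0 & Q x e.2 st'.1]
  & forall x, x \in xs -> x.1 :&: B != set0 ->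
      exists2 c, (x.1 :&: B, c) \in E & Q x c st'.1].
Proof.
move=> Q_mono; elim: xs st => [|x xs IH] st body_ok Inv_st /=.
  by exists [::], st; split=> //; split.
have := body_ok x st (mem_head _ _) Inv_st.
have body_ok' y st0 : y \in xs -> _ :=
  fun yxs => body_ok y st0 (mem_behead (s := x :: xs) yxs).
case: ifP => [s0 ->|s_ne [c [st1 [-> Inv_st1 ext1 Qc]]]].
  have [E [st' [-> Inv_st' E1 sndE cplE]]] := IH _ body_ok' Inv_st.
  exists E, st'; split=> // [e|y].
    by case/sndE=> y [yxs ey y_ne Qy]; exists y; rewrite inE yxs orbT.
  rewrite inE => /orP[/eqP->|]; first by rewrite s0.
  exact: cplE.
have [E [st' [-> [Inv_st' ext'] E1 sndE cplE]]] := IH _ body_ok' Inv_st1.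
have Qc' := Q_mono _ _ _ _ ext' Qc.
exists ((x.1 :&: B, c) :: E), st'; split=> //=.
- by split=> //; exact: extends_trans ext1 ext'.
- by rewrite E1.
- move=> e; rewrite inE => /orP[/eqP->|/sndE[y [yxs ey y_ne Qy]]].
    by exists x; rewrite mem_head s_ne.
  by exists y; rewrite inE yxs orbT.
move=> y; rewrite inE => /orP[/eqP-> _|yxs /(cplE _ yxs)[d dE Qd]].
  by exists c => //; exact: mem_head.
by exists d => //; rewrite inE dE orbT.
Qed.

Lemma branches_disjoint v1 (es1 : seq (edge T v1)) v2 (es2 : seq (edge T v2)) D2 :
  disjoint_seq (unzip1 es1) -> disjoint_seq (unzip1 es2) ->
  disjoint_seq (unzip1 (branches es1 es2 D2)).
Proof.
rewrite /branches; case: (v2 =P v1) => [eq_v|_].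
  case: v1 / eq_v es1 => es1 /= dis1 dis2.
  rewrite /unzip1 map_allpairs /=.
  have := disjoint_seq_allpairs dis1 dis2.
  by rewrite /unzip1 allpairs_mapl allpairs_mapr.
by rewrite /unzip1 -map_comp.
Qed.

(** For equal variables [x] lies in one set of each root, hence in their intersection; otherwise the
    first root alone covers [f1 v1]. *)
Lemma branches_cover v1 (es1 : seq (edge T v1)) v2 (es2 : seq (edge T v2)) D2
    f1 f2 x :
  splits (f1 v1) (unzip1 es1) -> splits (f2 v2) (unzip1 es2) ->
  x \in f1 v1 -> x \in f2 v1 ->
  has (fun s : {set T v1} => x \in s) (unzip1 (branches es1 es2 D2)).
Proof.
case=> _ _ cov1 [_ _ cov2]; rewrite cov1 => /hasP[_ /mapP[e1 e1_es ->] xe1].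
rewrite /branches; case: (v2 =P v1) => [eq_v|_ _].
  case: v1 / eq_v es1 x e1 e1_es cov1 xe1 => es1 x e1 e1_es cov1 xe1 /=.
  rewrite cov2 => /hasP[_ /mapP[e2 e2_es ->] xe2].
  apply/hasP; exists (e1.1 :&: e2.1); last by rewrite inE xe1.
  apply/mapP; exists (e1.1 :&: e2.1, (e1.2, e2.2)) => //.
  by apply/allpairsP; exists (e1, e2).
apply/hasP; exists e1.1 => //; rewrite /unzip1 -map_comp.
by apply/mapP; exists e1.
Qed.

Lemma dfwith_sub p f v (s s' : {set T v}) : (forall w, p w \subset f w) ->
  s \subset s' -> forall w, dfwith p s w \subset dfwith f s' w.
Proof.
move=> sub ss' w; case: (eqVneq v w) => [<-|ne]; first by rewrite !dfwith_in.
by rewrite !dfwith_out.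
Qed.

Lemma dfwith_subl p f v (s : {set T v}) : (forall w, p w \subset f w) ->
  s \subset p v -> forall w, dfwith p s w \subset f w.
Proof.
move=> sub sp w; case: dfwithP => [|w' _]; last exact: sub.
exact: subset_trans sp (sub _).
Qed.

(** * Correctness of the recursion *)

Section Correctness.

Variable M0 : memory.

Local Notation bounded_wto0 := (bounded_wto M0 (fun=> True)).

Definition occurs2 N1 N2 v := occurs M0 v N1 \/ occurs M0 v N2.

(** Where an edge is followed, the feasible set shrinks to the edge set, which contains [s]. For
    distinct variables the second node stays, and [f2] still contains the smaller assignment. *)
Lemma branch_child k1 f1 N1 v1 es1 k2 f2 N2 v2 es2 p x (s : {set T v1}) :
  bounded_wto0 k1.+1 f1 N1 -> onth M0 N1 = Some (Test v1 es1) ->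
  bounded_wto0 k2 f2 N2 -> onth M0 N2 = Some (Test v2 es2) ->
  (forall v, p v \subset f1 v) -> (forall v, p v \subset f2 v) ->
  x \in branches es1 es2 N2 -> s \subset x.1 -> s \subset p v1 ->
  [/\ exists2 f1', bounded_wto0 k1 f1' x.2.1
        & forall v, dfwith p s v \subset f1' v,
      exists2 f2', bounded_wto0 k2 f2' x.2.2
        & forall v, dfwith p s v \subset f2' v
    & forall v, occurs2 x.2.1 x.2.2 v -> occurs2 N1 N2 v].
Proof.
move=> wto1 N1_test wto2 N2_test pf1 pf2.
have [_ _ _ sub1] := bounded_wto_test wto1 N1_test.
rewrite /branches; case: (v2 =P v1) => [eq_v|_].
  case: v1 / eq_v es1 s x N1_test sub1 => es1 s x N1_test sub1 /=.
  case/allpairsP=> -[e1 e2] [/= e1_es e2_es ->] /=.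
  rewrite subsetI => /andP[s1 s2] sp.
  split.
  - by exists (dfwith f1 e1.1); [exact: sub1 | exact: dfwith_sub].
  - exists (dfwith f2 e2.1); last exact: dfwith_sub.
    have [_ _ _ /(_ _ e2_es)] := bounded_wto_test wto2 N2_test.
    by move=> wto_e2; apply: bounded_wtoW wto_e2 => //; exact: leq_pred.
  by move=> v []; [left | right];
    [exact: occurs_child N1_test e1_es _ | exact: occurs_child N2_test e2_es _].
case/mapP=> e1 e1_es -> /= s1 sp; split.
- by exists (dfwith f1 e1.1); [exact: sub1 | exact: dfwith_sub].
- by exists f2 => //; exact: dfwith_subl.
by move=> v []; [left | right] => //; exact: occurs_child N1_test e1_es _.
Qed.

Lemma branch_reaches N1 v1 es1 N2 v2 es2 I l1 l2 :
  onth M0 N1 = Some (Test v1 es1) -> onth M0 N2 = Some (Test v2 es2) ->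
  reaches M0 I N1 l1 -> reaches M0 I N2 l2 ->
  exists x, [/\ x \in branches es1 es2 N2, I v1 \in x.1,
    reaches M0 I x.2.1 l1 & reaches M0 I x.2.2 l2].
Proof.
move=> N1_test N2_test /reachesP; rewrite N1_test => -[e1 [e1_es Ie1 re1]] r2.
rewrite /branches; case: (v2 =P v1) => [eq_v|_].
  case: v1 / eq_v es1 e1 N1_test e1_es Ie1 re1 => es1 e1 N1_test e1_es Ie1 re1.
  move/reachesP: r2; rewrite N2_test => -[e2 [e2_es Ie2 re2]].
  exists (e1.1 :&: e2.1, (e1.2, e2.2)); split=> //=; last by rewrite inE Ie1.
  by apply/allpairsP; exists (e1, e2).
by exists (e1.1, (e1.2, N2)); split=> //; apply/mapP; exists e1.
Qed.

(** Both halves depend on [p] only through the occurring variables, which is what lets a cached node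
    serve another assignment. *)
Definition result M N1 N2 op p D3 :=
  (exists k, bounded_wto M (occurs2 N1 N2) k p D3) /\
  forall I l1 l2, (forall v, occurs2 N1 N2 v -> I v \in p v) ->
    reaches M0 I N1 l1 -> reaches M0 I N2 l2 ->
    reaches M I D3 (eval_op op l1 l2).

Lemma result_eq M M' N1 N2 op p p' D3 : extends M M' ->
  (forall v, occurs2 N1 N2 v -> p v = p' v) ->
  result M N1 N2 op p D3 -> result M' N1 N2 op p' D3.
Proof.
move=> ext eq_p [[k wto3] red3]; split=> [|I l1 l2 Ip r1 r2].
  by exists k; exact: bounded_wtoW wto3.
apply: reaches_extends ext _; apply: red3 => // v occ.
by rewrite eq_p // Ip.
Qed.

(* A cache hit may come from another assignment with the same key, so an     *)
(* entry has to be correct for all of them.                                  *)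
Definition cache_correct M C := forall N1 N2 rho op D3,
  ((N1, N2, rho, op), D3) \in C ->
  forall p vs, rho = restriction p vs ->
  (forall v, occurs2 N1 N2 v -> v \in vs) -> result M N1 N2 op p D3.

Lemma cache_correct_extends M M' C :
  extends M M' -> cache_correct M C -> cache_correct M' C.
Proof.
move=> ext ok N1 N2 rho op D3 inC p vs rhoE vsE.
by apply: result_eq ext _ (ok _ _ _ _ _ inC _ _ rhoE vsE).
Qed.

(** Equal keys have the same variable list and the same sets on it, hence come from assignments that
    agree on every occurring variable. *)
Lemma cache_correct_cons M C N1 N2 op p vs D3 :
  cache_correct M C -> result M N1 N2 op p D3 ->
  cache_correct M (((N1, N2, restriction p vs, op), D3) :: C).
Proof.
move=> ok res N1' N2' rho op' D3'; rewrite inE => /orP[|/ok//].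
case/eqP=> -> -> -> -> -> p' vs' rhoE vsE; apply: result_eq res => // v occ.
by apply: (eq_restriction rhoE); rewrite (restriction_domain rhoE) vsE.
Qed.

(** Since [p] is contained in [f], the feasible sets [f v :&: p v] of the copy are exactly [p v]. *)
Lemma result_copy M N1 N2 op p k f D : extends M0 M ->
  bounded_wto0 k f D -> k <= size M ->
  (forall v, p v \subset f v) -> (forall v, p v != set0) ->
  (forall v, occurs M0 v D -> occurs2 N1 N2 v) ->
  (forall I l1 l2, reaches M0 I N1 l1 -> reaches M0 I N2 l2 ->
     reaches M0 I D (eval_op op l1 l2)) ->
  let copy := restricted_copy M D p in result copy.2 N1 N2 op p copy.1.
Proof.
move=> ext wtoD le_k pf p_ne occ red /=.
have D0 : D \in expansion M 0 D by exact: mem_head.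
split=> [|I l1 l2 Ip r1 r2].
  exists k; apply: (bounded_wto_copy ext wtoD) D0 le_k => // v.
  exact/esym/setIidPr.
apply: (reaches_copy ext wtoD) D0 le_k _ => [v /occ/Ip//|].
exact: red.
Qed.

Lemma simplify_cases op b B D : simplify op b B D \in [:: B; D].
Proof. by case: op b => -[]; rewrite !inE eqxx ?orbT. Qed.

Lemma reaches_simplify op b B D I l1 l2 : onth M0 B = Some (Leaf b) ->
  reaches M0 I B l1 -> reaches M0 I D l2 ->
  reaches M0 I (simplify op b B D) (eval_op op l1 l2).
Proof.
move=> Bb /reachesP; rewrite Bb => -> r2.
by case: op b Bb => -[] Bb //=; exact: reaches_leaf.
Qed.

Lemma eval_opC op : commutative (eval_op op).
Proof. by case: op; [exact: andbC | exact: orbC]. Qed.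

Definition applies k N1 N2 op p (st : state) :=
  exists D3 st', [/\ apply_rec k N1 N2 p op st = Some (D3, st'),
    extends st.1 st'.1, cache_correct st'.1 st'.2
  & result st'.1 N1 N2 op p D3].

(** Induction on [k1], at once the fuel and the depth bound of the first graph: every recursive call
    descends there, while the second node may stay. *)
Lemma apply_rec_correct k1 f1 k2 f2 N1 N2 op p (st : state) :
  bounded_wto0 k1 f1 N1 -> k1 <= size M0 ->
  bounded_wto0 k2 f2 N2 -> k2 <= size M0 ->
  (forall v, p v \subset f1 v) -> (forall v, p v \subset f2 v) ->
  (forall v, p v != set0) ->
  extends M0 st.1 -> cache_correct st.1 st.2 ->
  applies k1 N1 N2 op p st.
Proof.
elim: k1 f1 f2 N1 N2 p k2 st => // k1 IH f1 f2 N1 N2 p k2 [M C].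
move=> wto1 le1 wto2 le2 pf1 pf2 p_ne /= ext okC.
have leM := extends_size ext.
have applies_copy D k f : D \in [:: N1; N2] -> bounded_wto0 k f D ->
    k <= size M -> (forall v, p v \subset f v) ->
    (forall I l1 l2, reaches M0 I N1 l1 -> reaches M0 I N2 l2 ->
       reaches M0 I D (eval_op op l1 l2)) ->
    apply_rec k1.+1 N1 N2 p op (M, C) =
      Some ((restricted_copy M D p).1, ((restricted_copy M D p).2, C)) ->
    applies k1.+1 N1 N2 op p (M, C).
  move=> D12 wtoD leD pfD redD eq_apply.
  have extD : extends M _ := extends_restricted_copy D p.
  exists (restricted_copy M D p).1, ((restricted_copy M D p).2, C); split=> //.
    exact: cache_correct_extends okC.
  apply: result_copy wtoD _ _ _ _ redD => // v.
  by move: D12; rewrite !inE => /orP[]/eqP->; [left | right].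
have applies_simplify D : D \in [:: N1; N2] ->
    (forall I l1 l2, reaches M0 I N1 l1 -> reaches M0 I N2 l2 ->
       reaches M0 I D (eval_op op l1 l2)) ->
    apply_rec k1.+1 N1 N2 p op (M, C) =
      Some ((restricted_copy M D p).1, ((restricted_copy M D p).2, C)) ->
    applies k1.+1 N1 N2 op p (M, C).
  move=> D12; move: (D12); rewrite !inE => /orP[]/eqP DE.
    apply: applies_copy D12 _ (leq_trans le1 leM) pf1; by rewrite DE.
  apply: applies_copy D12 _ (leq_trans le2 leM) pf2; by rewrite DE.
case N1E: (onth M0 N1) => [c1|]; last by rewrite /= N1E in wto1.
case N2E: (onth M0 N2) => [c2|]; last by case: k2 wto2 {le2} => //= k2; rewrite N2E.
case: c1 N1E => [b1|v1 es1] N1E.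
  apply: (applies_simplify (simplify op b1 N1 N2)) => //.
  - exact: simplify_cases.
  - by move=> I l1 l2; exact: reaches_simplify.
  by rewrite /= (ext _ _ N1E) (ext _ _ N2E).
case: c2 N2E => [b2|v2 es2] N2E.
  apply: (applies_simplify (simplify op b2 N2 N1)) => //.
  - by have := simplify_cases op b2 N2 N1; rewrite !inE orbC.
  - by move=> I l1 l2 r1 r2; rewrite eval_opC; exact: reaches_simplify.
  by rewrite /= (ext _ _ N1E) (ext _ _ N2E).
rewrite /applies /= (ext _ _ N1E) (ext _ _ N2E).
set vs := occurring M N1 N2; set K : key T := (N1, N2, _, op).
(* The key is computed in the grown memory [M], yet lists every variable occurring in [M0]. *)
have vsE v : occurs2 N1 N2 v -> v \in vs.
  have leM1 := leq_trans le1 leM; have leM2 := leq_trans le2 leM.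
  by case; [apply: occurs_occurring wto1 _ _ | apply: occurs_occurring wto2 _ _];
    rewrite // !inE eqxx ?orbT.
case hit: (lookup K C) => [D3|].
  exists D3, (M, C); split=> //.
  exact: (okC _ _ _ _ _ (lookup_mem hit) p vs).
have [_ _ spl1 _] := bounded_wto_test wto1 N1E.
have [_ _ spl2 _] := bounded_wto_test wto2 N2E.
pose Inv (st : state) := extends M0 st.1 /\ cache_correct st.1 st.2.
pose Q (x : {set T v1} * (nat * nat)) c M1 :=
  result M1 x.2.1 x.2.2 op (dfwith p (x.1 :&: p v1)) c.
have child x s := branch_child (s := s) wto1 N1E wto2 N2E pf1 pf2 (x := x).
have [|x st0 x_br [ext0 okC0]||] :=
  for_each_edges (B := p v1) (Inv := Inv) (Q := Q) (st := (M, C))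
    (body := fun x st => let: (s0, (c1, c2)) := x in
        let s := s0 :&: p v1 in
        if s == set0 then Some ([::], st) else
        if apply_rec k1 c1 c2 (dfwith p s) op st is Some (c, st')
        then Some ([:: (s, c)], st') else None)
    (xs := branches es1 es2 N2) _ _ _.
- by move=> x c M1 M2 ext12; exact: result_eq.
- case: x x_br => s0 [c1 c2] x_br /=; case: ifPn => [->//|s_ne].
  rewrite (negbTE s_ne).
  have [[g1 wtoc1 pg1] [g2 wtoc2 pg2] _] :=
    child _ _ x_br (subsetIl s0 (p v1)) (subsetIr s0 (p v1)).
  have ps_ne v : dfwith p (s0 :&: p v1) v != set0.
    by case: dfwithP => [|w _]; [exact: s_ne | exact: p_ne].
  have [D3 [st' [-> ext' okC' res']]] :=
    IH _ _ _ _ _ _ st0 wtoc1 (ltnW le1) wtoc2 le2 pg1 pg2 ps_ne ext0 okC0.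
  exists D3, st'; split=> //; split=> //; exact: extends_trans ext0 ext'.
- by [].
move=> E [[M' C'] [-> [[ext0' okC'] extM'] E1 sndE cplE]].
have extR : extends M' (rcons M' (Test v1 E)).
  by rewrite -cats1; exact: extends_cat.
have newE : onth (rcons M' (Test v1 E)) (size M') = Some (Test v1 E).
  by rewrite -cats1 onth_cat ltnn subnn.
have res : result (rcons M' (Test v1 E)) N1 N2 op p (size M').
  split=> [|I l1 l2 Ip r1 r2].
    (* The children come with separate depth bounds; a common one plus one serves the new node. *)
    have [|e eE|k wtoE] := seq_uniform_bound (s := E) (P := fun k e =>
      bounded_wto (rcons M' (Test v1 E)) (occurs2 N1 N2) k (dfwith p e.1) e.2).
    - by move=> i j e le_ij; exact: bounded_wtoW.
    - have [x [x_br -> s_ne [[k wto_x] _]]] := sndE _ eE.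
      have [_ _ occ_x] := child _ _ x_br (subsetIl _ (p v1)) (subsetIr _ (p v1)).
      by exists k; exact: bounded_wtoW wto_x.
    exists k.+1; rewrite /= newE; split=> //.
      by left; exact: occurs_root N1E.
    rewrite E1; apply: splits_restrict.
      by apply: branches_disjoint; [case: spl1 | case: spl2].
    (* A state in [p v1] is feasible for both graphs, so some branch contains it. *)
    by move=> x xp; apply: (branches_cover _ spl1 spl2);
      [exact: subsetP (pf1 v1) _ xp | exact: subsetP (pf2 v1) _ xp].
  (* The branch followed by [I] keeps [I v1] after intersection with [p v1], so it was not skipped
     and became an edge. *)
  have [x [x_br Ix rx1 rx2]] := branch_reaches N1E N2E r1 r2.
  have Ip1 : I v1 \in p v1 by apply: Ip; left; exact: occurs_root N1E.
  have Is : I v1 \in x.1 :&: p v1 by rewrite inE Ix.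
  have s_ne : x.1 :&: p v1 != set0 by apply/set0Pn; exists (I v1).
  have [c cE [_ red_c]] := cplE _ x_br s_ne.
  apply: (reaches_test newE cE Is); apply: reaches_extends extR _.
  have [_ _ occ_x] := child _ _ x_br (subsetIl _ (p v1)) (subsetIr _ (p v1)).
  by apply: red_c => // v /occ_x/Ip; case: dfwithP.
exists (size M'), (rcons M' (Test v1 E), (K, size M') :: C'); split=> //=.
  exact: extends_trans extM' extR.
by apply: cache_correct_cons => //; exact: cache_correct_extends okC'.
Qed.

End Correctness.

End Apply.

Theorem mainTheorem2 (V : eqType) (T : V -> finType)
    (two_states : forall v, 1 < #|T v|)
    (M : memory T bool) (D1 D2 : nat) (op : boolop)
    (graph1 : decision_graph M D1) (wto1 : weak_test_once M D1)
    (graph2 : decision_graph M D2) (wto2 : weak_test_once M D2) :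
  exists D3 M',
    [/\ Apply M D1 D2 (@all_states V T) op = Some (D3, M'),
        decision_graph M' D3,
        weak_test_once M' D3
      & forall I : instance T, exists l1 l2,
          [/\ evaluates M D1 I l1, evaluates M D2 I l2
            & evaluates M' D3 I (eval_op op l1 l2)]].
Proof.
have b1 := weak_test_once_bounded graph1 wto1.
have b2 := weak_test_once_bounded graph2 wto2.
have all_ne v : all_states T v != set0.
  by rewrite -card_gt0 cardsT; exact: ltnW.
(* Initially [f1], [f2] and [p] all allow every state, and the empty cache is trivially correct. *)
have [//|D3 [[M' C'] [eq_apply _ _ [[k b3] red3]]]] :=
  apply_rec_correct (st := (M, [::])) op b1 (leqnn _) b2 (leqnn _)
    (fun=> subxx _) (fun=> subxx _) all_ne (@extends_refl _ _ _ _).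
exists D3, M'; split.
- by rewrite /Apply eq_apply.
- exact: bounded_wto_decision_graph b3.
- exact: bounded_wto_weak_test_once b3.
move=> I; have I_all v : I v \in all_states T v by rewrite inE.
have [l1 r1] := bounded_wto_reaches b1 I_all.
have [l2 r2] := bounded_wto_reaches b2 I_all.
exists l1, l2; split; first exact: bounded_wto_evaluates b1 r1.
  exact: bounded_wto_evaluates b2 r2.
by apply: bounded_wto_evaluates b3 _; exact: red3.
Qed.
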